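(* Let $\alpha\in(0,1)$ and let $A\in L(H)$ be such that the zero equilibrium of the Riemann-Liouville equation $$\tau(1-\tau^{-1})^\alpha u=Au+\delta_{-1}x$$ or of the Caputo equation $$\tau(1-\tau^{-1})^\alpha u=Au+(1-\tau^{-1})^\alpha\chi_{\mathbb{Z}_{\ge-1}}x$$ is asymptotically stable. For $\mu>1$ let $f_\mu:S_\mu\to\mathbb{C}$, $f_\mu(z)=z(1-z^{-1})^\alpha$. Then for all $\mu>1$ the operator $\tau(1-\tau^{-1})^\alpha-A$ is invertible in $\ell_{2,\mu}(\mathbb{Z};H)$ with causal inverse, i.e., for each $\mu>1$, $\sigma(A)\cap\operatorname{ran}f_\mu=\emptyset$.
   Context: $H$ is a complex separable Hilbert space, $L(H)$ the bounded linear operators on $H$, $\sigma(A)$ the spectrum of $A$, $\mathbb{N}=\{0,1,2,\dots\}$. For $\rho>0$, $S_\rho=\{z\in\mathbb{C}:|z|=\rho\}$ and $\ell_{2,\rho}(\mathbb{Z};H)=\{x\in H^{\mathbb{Z}} : \sum_{k\in\mathbb{Z}}\|x_k\|_H^2\rho^{-2k}<\infty\}$, a Hilbert space with norm $(\sum_k\|x_k\|_H^2\rho^{-2k})^{1/2}$. $\tau$ is the shift $(\tau x)_k=x_{k+1}$, a bounded invertible operator on $\ell_{2,\rho}(\mathbb{Z};H)$. The operator $A\in L(H)$ also denotes the bounded operator $(x_k)_k\mapsto(Ax_k)_k$ on $\ell_{2,\rho}(\mathbb{Z};H)$. ''Invertible'' means bijective with bounded inverse. For $u\in H^{\mathbb{Z}}$,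 $\operatorname{spt}u=\{n\in\mathbb{Z}:u_n\ne0\}$. For $x\in H$, $n\in\mathbb{Z}$, $\delta_nx\in H^{\mathbb{Z}}$ is the sequence with value $x$ at index $n$ and $0$ elsewhere, and $\chi_{\mathbb{Z}_{\ge n}}x$ is the sequence with value $x$ at all indices $m\ge n$ and $0$ for $m<n$. A linear operator $B$ on $\ell_{2,\rho}(\mathbb{Z};H)$ is causal if for all $a\in\mathbb{Z}$ and $g\in\ell_{2,\rho}(\mathbb{Z};H)$: $\operatorname{spt}g\subseteq\mathbb{Z}_{\ge a}$ implies $\operatorname{spt}Bg\subseteq\mathbb{Z}_{\ge a}$. For $|w|<1$ and $\alpha\in\mathbb{C}$, $(1+w)^\alpha:=\sum_{k=0}^\infty\binom{\alpha}{k}w^k$, where $\binom{\alpha}{0}=1$, $\binom{\alpha}{k}=\frac{\alpha(\alpha-1)\cdots(\alpha-k+1)}{k!}$. For $\rho>1$, the operator $(1-\tau^{-1})^\alpha$ on $\ell_{2,\rho}(\mathbb{Z};H)$ is defined as $\mathcal{Z}_\rho^*\,(1-z^{-1})^\alpha\,\mathcal{Z}_\rho$ (multiplication by $(1-z^{-1})^\alpha$ in the middle), where $\mathcal{Z}_\rho:\ell_{2,\rho}(\mathbb{Z};H)\to L_2(S_\rho;H)$ is the unitary transform $x\mapsto(z\mapsto\sum_k x_kz^{-k})$ (the series converging in $L_2(S_\rho;H)$, whose norm is $(\frac1{2\pi}\int_{S_\rho}\|f(z)\|_H^2\frac{|dz|}{|z|})^{1/2}$); equivalently, $((1-\tau^{-1})^\alpha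 u)_n=\sum_{k=0}^\infty(-1)^k\binom{\alpha}{k}u_{n-k}$ for $n\in\mathbb{Z}$. Asymptotic stability: the zero equilibrium (the solution $u=0$ for initial value $x=0$) of the Riemann-Liouville equation, respectively of the Caputo equation, is asymptotically stable if for every $\rho>1$, every solution $u\in\ell_{2,\rho}(\mathbb{Z};H)$ of that equation (for any initial value $x\in H$) with $\operatorname{spt}u\subseteq\mathbb{N}$ satisfies $\lim_{n\to\infty}u_n=0$ in $H$. *)

(* Defs.v *)
From HB Require Import structures.
From mathcomp Require Import all_boot all_order all_algebra.
From mathcomp Require Import all_classical all_reals all_analysis.
From mathcomp Require Import complex.

Set Implicit Arguments.
Unset Strict Implicit.
Unset Printing Implicit Defensive.

Import Order.TTheory GRing.Theory Num.Theory.
Import numFieldNormedType.Exports.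

Local Open Scope classical_set_scope.
Local Open Scope ring_scope.

(* `dot` (linear in its first argument, conjugate-linear in the second) induces
   the norm of the complete space H, i.e. makes H a complex Hilbert space. *)
Definition hilbert_norm (R : realType) (H : completeNormedModType R[i])
    (dot : {dot H for @Num.conj R[i]}) : Prop :=
  forall x : H, `|x| ^+ 2 = dot x x.

Definition separable_space (T : topologicalType) : Prop :=
  exists2 D : set T, countable D & dense D.

(* In MathComp-Analysis the norm of a complex normed space is R[i]-valued. *)
Definition rnorm (R : realType) (H : normedModType R[i]) (x : H) : R :=
  complex.Re `|x|.

Definition bounded_invertible (K : numFieldType) (H : normedModType K)
    (T : H -> H) : Prop :=
  exists B : {linear H -> H}, [/\ continuous B, cancel T B & cancel B T].

Definition spectrum (K : numFieldType) (H : normedModType K)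
    (A : H -> H) : set K :=
  [set l | ~ bounded_invertible (fun x => l *: x - A x)].

Section Sequences.
Context {R : realType} {H : normedModType R[i]}.
Implicit Types (rho : R) (u g : int -> H).

Definition l2_energy rho u : \bar R :=
  \esum_(k in [set: int]) (rnorm (u k) ^+ 2 * rho ^ (- 2%:Z * k))%:E.

Definition l2 rho : set (int -> H) := [set u | (l2_energy rho u < +oo)%E].

Definition l2_norm rho u : R := Num.sqrt (fine (l2_energy rho u)).

Definition spt u : set int := [set n | u n <> 0].

(* Operators on l2 rho are represented by total maps on sequences, of which only
   the values on l2 rho matter. *)
Definition l2_bounded_operator rho (T : (int -> H) -> (int -> H)) : Prop :=
  [/\ forall u, l2 rho u -> l2 rho (T u),
      forall (c : R[i]) u g, l2 rho u -> l2 rho g ->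
        T (c *: u + g) = c *: T u + T g
    & exists M : R, forall u, l2 rho u -> l2_norm rho (T u) <= M * l2_norm rho u].

Definition l2_inverse rho (T B : (int -> H) -> (int -> H)) : Prop :=
  l2_bounded_operator rho B /\
  forall u, l2 rho u -> B (T u) = u /\ T (B u) = u.

Definition causal rho (B : (int -> H) -> (int -> H)) : Prop :=
  forall (a : int) g, l2 rho g ->
    spt g `<=` [set n | a <= n] -> spt (B g) `<=` [set n | a <= n].

Definition invertible_with_causal_inverse rho
    (T : (int -> H) -> (int -> H)) : Prop :=
  l2_bounded_operator rho T /\ exists B, l2_inverse rho T B /\ causal rho B.

Definition shift u : int -> H := fun k => u (k + 1).

Definition delta (n : int) (x : H) : int -> H :=
  fun m => if m == n then x else 0.

Definition chi_ge (n : int) (x : H) : int -> H :=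
  fun m => if n <= m then x else 0.

End Sequences.

Definition gbinom (K : fieldType) (a : K) (k : nat) : K :=
  (\prod_(i < k) (a - i%:R)) / k`!%:R.

(* (1 + w) ^ a, for |w| < 1 *)
Definition pow1p (K : numFieldType) (a w : K) : K :=
  limn (series (fun k : nat => gbinom a k * w ^+ k)).

(* (1 - tau^-1) ^ a on l2 rho, rho > 1, where the series converges absolutely *)
Definition frac_diff (R : realType) (H : normedModType R[i]) (a : R[i])
    (u : int -> H) : int -> H :=
  fun n => limn (series (fun k : nat => ((-1) ^+ k * gbinom a k) *: u (n - k%:Z))).

Definition circle (R : realType) (mu : R) : set R[i] :=
  [set z | `|z| = (mu%:C)%C].

Definition symbol (R : realType) (a z : R[i]) : R[i] := z * pow1p a (- z^-1).

Section Equations.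
Context {R : realType} {H : normedModType R[i]}.
Variables (a : R[i]) (A : H -> H).

Definition RL_solution (x : H) (u : int -> H) : Prop :=
  shift (frac_diff a u) = (A \o u) + delta (-1) x.

Definition Caputo_solution (x : H) (u : int -> H) : Prop :=
  shift (frac_diff a u) = (A \o u) + frac_diff a (chi_ge (-1) x).

Definition frac_operator (u : int -> H) : int -> H :=
  shift (frac_diff a u) - (A \o u).

End Equations.

Definition asymptotically_stable (R : realType) (H : normedModType R[i])
    (solution : H -> (int -> H) -> Prop) : Prop :=
  forall rho : R, 1 < rho -> forall (x : H) (u : int -> H),
    l2 rho u -> spt u `<=` [set n | 0 <= n] -> solution x u ->
    (fun n : nat => u n%:Z) @ \oo --> (0 : H).

(* Main.v *)
Require Import Defs.
From HB Require Import structures.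
From mathcomp Require Import all_boot all_order all_algebra.
From mathcomp Require Import all_classical all_reals all_analysis.
From mathcomp Require Import complex.
From mathcomp Require finmap.
From mathcomp Require Import ring lra zify.

(** Why the proposition holds. Write c_k for the coefficients of
    (1 - w)^alpha. Up to one shift, the operator tau (1 - tau^-1)^alpha - A
    is the convolution with the operator-valued sequence P_0 = 1,
    P_1 = c_1 - A, P_k = c_k for k >= 2 ([pencil], [frac_operatorE]). The
    constant term of P is the identity, so P has an inverse Q in the ring of
    formal power series over L(H) ([resolvent]); it is two-sided because its
    coefficients commute with A.

    The solution supported in the nonnegative integers with initial value x
    is the convolution b * Q x, where b is the unit series 1 for the
    Riemann-Liouville equation and (1 - w)^(alpha - 1) for the Caputo equation
    ([RL_solution_map], [Caputo_solution_map]). A crude a priori bound shows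
    that it grows at most exponentially, so it lies in l2 rho for large rho and
    stability makes it tend to 0, for every x. By the principle of uniform
    boundedness the operators (b * Q)_n are bounded uniformly in n. Dividing
    by b means convolving with 1, respectively (1 - w)^(1 - alpha), whose
    coefficients are at most 1 in modulus; hence the norm of Q_n is O(n)
    ([stable_resolvent_subexponential]).

    Consequently the norms of Q_n are summable against mu^-n for every mu > 1.
    By Young's inequality the convolution with Q is bounded on l2 mu
    ([opconv_energy]); it inverts the convolution with P because the Cauchy
    product Q P is 1 ([opconv_inverse]); and it only looks into the past, so
    it is causal.

    For the spectrum, let f denote the symbol and |z| = mu. The sequence
    n |-> z^n x is mapped by the operator to n |-> z^n (f(z) x - A x)
    ([frac_operator_expseq]), and convolution with Q also preserves sequences
    of this exponential form. Inverting the operator on them thus inverts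
    f(z) - A. These sequences only satisfy |u_n| <= C mu^n and are not in
    l2 mu, which is why the inversion formula is proved for all sequences with
    such a bound ([expbounded]). *)

Set Implicit Arguments.
Unset Strict Implicit.
Unset Printing Implicit Defensive.

Import Order.TTheory GRing.Theory Num.Theory.
Import numFieldNormedType.Exports.

Local Open Scope classical_set_scope.
Local Open Scope ring_scope.

(** * The real-valued norm *)

Section RealNorm.
Context {R : realType} {V : normedModType R[i]}.
Implicit Types (x y : V) (c : R[i]).

Lemma normr_rnorm x : `|x| = ((rnorm x)%:C)%C.
Proof. by rewrite /rnorm RRe_real// normr_real. Qed.

Lemma rnorm_ge0 x : 0 <= rnorm x.
Proof. by rewrite -lecR -normr_rnorm normr_ge0. Qed.

Lemma rnorm0 : rnorm (0 : V) = 0.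
Proof. by apply/(@complexI R); rewrite -normr_rnorm normr0. Qed.

Lemma rnormN x : rnorm (- x) = rnorm x.
Proof. by rewrite /rnorm normrN. Qed.

Lemma rnormB x y : rnorm (x - y) = rnorm (y - x).
Proof. by rewrite /rnorm distrC. Qed.

Lemma ler_rnormD x y : rnorm (x + y) <= rnorm x + rnorm y.
Proof. by rewrite -lecR rmorphD /= -!normr_rnorm ler_normD. Qed.

Lemma ler_rnormB x y : rnorm (x - y) <= rnorm x + rnorm y.
Proof. by rewrite -(rnormN y) ler_rnormD. Qed.

Lemma rnormZ c x : rnorm (c *: x) = rnorm (c : R[i]^o) * rnorm x.
Proof. by apply/(@complexI R); rewrite rmorphM /= -!normr_rnorm normrZ. Qed.

Lemma ler_rnorm_sum (I : Type) (r : seq I) (P : pred I) (f : I -> V) :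
  rnorm (\sum_(i <- r | P i) f i) <= \sum_(i <- r | P i) rnorm (f i).
Proof.
elim/big_ind2 : _ => //; first by rewrite rnorm0.
by move=> x a y b xa yb; apply: le_trans (ler_rnormD _ _) (lerD xa yb).
Qed.

Lemma ler_dist_rnorm x y : `|rnorm x - rnorm y| <= rnorm (x - y).
Proof.
have := ler_rnormD (x - y) y; have := ler_rnormD (y - x) x.
by rewrite !subrK rnormB ler_norml => yx xy; apply/andP; split; lra.
Qed.

Lemma rnorm_eq0 x : rnorm x = 0 -> x = 0.
Proof. by move=> x0; apply/normr0_eq0; rewrite normr_rnorm x0. Qed.

(** Convergence in a complex normed space is thereby a statement about real
    sequences, where order arguments are available. *)
Lemma cvg_rnormP (u : nat -> V) (l : V) :
  u @ \oo --> l <-> (fun n => rnorm (u n - l)) @ \oo --> (0 : R).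
Proof.
split=> [/cvgrPdist_lt ul|/cvgrPdist_lt ul].
- apply/cvgrPdist_lt => e e0.
  have eC : 0 < (e%:C)%C by rewrite ltcR.
  apply: filterS (ul _ eC) => n.
  by rewrite sub0r normrN ger0_norm ?rnorm_ge0// rnormB normr_rnorm ltcR.
- apply/cvgrPdist_lt => e; rewrite ltcE /= => /andP[/eqP e_re e0].
  apply: filterS (ul _ e0) => n.
  rewrite sub0r normrN ger0_norm ?rnorm_ge0// rnormB normr_rnorm ltcE /= e_re.
  by move=> ->; rewrite eqxx.
Qed.

End RealNorm.

Lemma rnorm_scalar (R : realType) (c : R[i]) : `|c| = ((rnorm (c : R[i]^o))%:C)%C.
Proof. exact: (normr_rnorm (c : R[i]^o)). Qed.

Lemma rnormM (R : realType) (c d : R[i]) :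
  rnorm (c * d : R[i]^o) = rnorm (c : R[i]^o) * rnorm (d : R[i]^o).
Proof. exact: (rnormZ c (d : R[i]^o)). Qed.

(** * Geometrically dominated series *)

Local Notation vsum f := (limn (series f)).

Section Geometric.
Context {R : realType}.
Implicit Types q C : R.

Lemma cvg_geometric0 C q : 0 <= q < 1 -> (fun n => C * q ^+ n) @ \oo --> (0 : R).
Proof.
move=> /andP[q0 q1]; apply: cvg_geometric; by rewrite ger0_norm.
Qed.

Lemma geometric_sum_le q (m n : nat) : 0 <= q < 1 ->
  \sum_(m <= k < n) q ^+ k <= q ^+ m / (1 - q).
Proof.
move=> /andP[q0 q1]; have q1' : 0 < 1 - q by rewrite subr_gt0.
have [mn|nm] := leqP m n; last first.
  by rewrite big_geq ?(ltnW nm)// divr_ge0 ?exprn_ge0// ltW.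
rewrite ler_pdivlMr// -(subnKC mn); elim: (n - m)%N => [|k IH].
  by rewrite addn0 big_geq// mul0r exprn_ge0.
have -> : \sum_(m <= i < m + k.+1) q ^+ i = q ^+ m + q * \sum_(m <= i < m + k) q ^+ i.
  rewrite addnS big_nat_recl ?leq_addr// mulr_sumr.
  by congr (_ + _); apply: eq_bigr => i _; rewrite exprS.
rewrite mulrDl -mulrA mulrBr mulr1.
have := ler_wpM2l q0 IH; rewrite [q ^+ m * q]mulrC; lra.
Qed.

(** Each of the n powers q^0, ..., q^(n-1) is at least q^n. *)
Lemma natr_geometric_le q n : 0 <= q < 1 -> n%:R * q ^+ n <= (1 - q)^-1.
Proof.
move=> q01; have := geometric_sum_le 0 n q01; rewrite expr0 mul1r.
apply: le_trans; rewrite mulr_natl -[X in _ *+ X]card_ord -sumr_const big_mkord.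
case/andP: q01 => q0 q1; apply: ler_sum => i _; rewrite ler_wiXn2l ?(ltW q1)//.
exact: ltnW.
Qed.

End Geometric.

Section GeometricSeries.
Context {R : realType} {V : completeNormedModType R[i]}.
Implicit Types (f g : nat -> V) (C q : R).

Lemma geometric_cvg f C q : 0 <= q < 1 ->
  (forall k, rnorm (f k) <= C * q ^+ k) -> cvgn (series f).
Proof.
move=> q01 fC; have C0 : 0 <= C.
  by have := fC 0%N; rewrite expr0 mulr1; apply: le_trans; exact: rnorm_ge0.
apply/cauchy_cvgP/cauchy_seriesP => e; rewrite ltcE /= => /andP[/eqP e_re e0].
have /cvgrPdist_lt/(_ _ e0)[N _ HN] := cvg_geometric0 (C / (1 - q)) q01.
exists ([set n | (N <= n)%N], setT) => /=.
  by split; [exists N|exact: filterT].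
move=> [m n] /= [Nm _].
rewrite normr_rnorm ltcE /= e_re eqxx /=.
apply: le_lt_trans (ler_rnorm_sum _ _ _) _.
apply: le_lt_trans (ler_sum _ (fun k _ => fC k)) _.
rewrite -mulr_sumr; apply: le_lt_trans (ler_wpM2l C0 (geometric_sum_le m n q01)) _.
have := HN m Nm; rewrite sub0r normrN; apply: le_lt_trans.
by rewrite mulrCA mulrA [_ * C]mulrC mulrAC ler_norm.
Qed.

(** All the series considered here are dominated by geometric ones, so that
    limits can be controlled by this explicit remainder. *)
Lemma geometric_tail f C q : 0 <= q < 1 ->
  (forall k, rnorm (f k) <= C * q ^+ k) ->
  forall N, rnorm (vsum f - \sum_(k < N) f k) <= C * q ^+ N / (1 - q).
Proof.
move=> q01 fC N; have C0 : 0 <= C.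
  by have := fC 0%N; rewrite expr0 mulr1; apply: le_trans; exact: rnorm_ge0.
have /cvg_rnormP fl := geometric_cvg q01 fC.
apply/ler_addgt0Pr => e e0.
have /cvgrPdist_lt/(_ _ e0)[M _ HM] := fl.
have := HM (maxn M N) (leq_maxl M N).
rewrite sub0r normrN ger0_norm ?rnorm_ge0// rnormB => lM.
rewrite -(subrKA (series f (maxn M N))) addrC.
apply: le_trans (ler_rnormD _ _) (lerD _ (ltW lM)).
rewrite /series /= -(big_mkord predT f).
rewrite (@big_cat_nat _ _ _ N 0 (maxn M N))//= ?leq_maxr// addrAC subrr add0r.
apply: le_trans (ler_rnorm_sum _ _ _) _.
apply: le_trans (ler_sum _ (fun k _ => fC k)) _.
by rewrite -mulr_sumr -[leRHS]mulrA; exact: ler_wpM2l C0 _ _ (geometric_sum_le _ _ q01).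
Qed.

Lemma vsum_le f C q : 0 <= q < 1 ->
  (forall k, rnorm (f k) <= C * q ^+ k) -> rnorm (vsum f) <= C / (1 - q).
Proof.
move=> q01 fC; have := geometric_tail q01 fC 0.
by rewrite big_ord0 subr0 expr0 mulr1.
Qed.

Lemma vsum_linear f g C D q (c : R[i]) : 0 <= q < 1 ->
  (forall k, rnorm (f k) <= C * q ^+ k) -> (forall k, rnorm (g k) <= D * q ^+ k) ->
  vsum (fun k => c *: f k + g k) = c *: vsum f + vsum g.
Proof.
move=> q01 fC gD; apply: cvg_lim => //.
have -> : series (fun k => c *: f k + g k) = (fun n => c *: series f n + series g n).
  by apply/funext => n; rewrite /series /= scaler_sumr -big_split.
apply: cvgD; last exact: geometric_cvg q01 gD.
by apply: cvgZl_tmp; exact: geometric_cvg q01 fC.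
Qed.

End GeometricSeries.

Section ComplexSeries.
Context {R : realType}.

Lemma rnorm_le_ReIm (z : R[i]) :
  rnorm (z : R[i]^o) <= `|complex.Re z| + `|complex.Im z|.
Proof.
rewrite -lecR -rnorm_scalar normc_def lecR.
rewrite -[leRHS]ger0_norm ?addr_ge0// -sqrtr_sqr ler_wsqrtr//.
  rewrite sqrrD !real_normK ?num_real// -addrA lerD2l addrC lerDl.
  by rewrite mulrn_wge0// mulr_ge0.
Qed.

Lemma Re_le_rnorm (z : R[i]) : `|complex.Re z| <= rnorm (z : R[i]^o).
Proof.
rewrite -lecR -rnorm_scalar normc_def lecR -[leLHS]sqrtr_sqr ler_wsqrtr//.
by rewrite lerDl sqr_ge0.
Qed.

Lemma Im_le_rnorm (z : R[i]) : `|complex.Im z| <= rnorm (z : R[i]^o).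
Proof.
rewrite -lecR -rnorm_scalar normc_def lecR -[leLHS]sqrtr_sqr ler_wsqrtr//.
by rewrite lerDr sqr_ge0.
Qed.

(** The series of real and imaginary parts converge absolutely. *)
Lemma complex_geometric_cvg (f : nat -> R[i]^o) (C q : R) : 0 <= q < 1 ->
  (forall k, rnorm (f k) <= C * q ^+ k) -> cvgn (series f).
Proof.
move=> q01 fC.
have real_cvg (p : R[i] -> R) : (forall z, `|p z| <= rnorm (z : R[i]^o)) ->
    cvgn (series (p \o f)).
  move=> ple; apply: normed_cvg.
  apply: (@series_le_cvg _ _ (geometric C q)) => //=.
  - by move=> n; apply: le_trans (fC n); exact: rnorm_ge0.
  - by move=> n; apply: le_trans (ple _) (fC n).
  - by apply: is_cvg_geometric_series; case/andP: q01 => q0 q1; rewrite ger0_norm.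
have /cvg_ex[a fa] := real_cvg _ Re_le_rnorm.
have /cvg_ex[b fb] := real_cvg _ Im_le_rnorm.
apply/cvg_ex; exists (a +i* b)%C; apply/(@cvg_rnormP R R[i]^o).
have h0 : (fun n => `|series (@complex.Re R \o f) n - a| +
                    `|series (@complex.Im R \o f) n - b|) @ \oo --> (0 : R).
  rewrite -[X in _ --> X](addr0 (0 : R)); apply: cvgD.
    by apply/norm_cvg0P/subr_cvg0.
  by apply/norm_cvg0P/subr_cvg0.
apply: (squeeze_cvgr _ (cvg_cst 0) h0).
apply: nearW => n; rewrite rnorm_ge0 /=.
have := rnorm_le_ReIm (series f n - (a +i* b)%C).
by rewrite !raddfB /= /series /= !raddf_sum.
Qed.

End ComplexSeries.

(** * Convolution with operator-valued sequences *)

Lemma sum_triangle (V : zmodType) (F : nat -> nat -> V) (N : nat) :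
  \sum_(j < N) \sum_(k < N - j) F j k = \sum_(m < N) \sum_(j < m.+1) F j (m - j)%N.
Proof.
elim: N => [|N IH]; first by rewrite !big_ord0.
rewrite [RHS]big_ord_recr /= -IH.
under eq_bigr => j _ do rewrite subSn -1?ltnS// big_ord_recr /=.
rewrite big_split /= big_ord_recr /= subnn big_ord0 addr0.
by [].
Qed.

Section Kernels.
Context {R : realType} {H : completeNormedModType R[i]}.
Implicit Types (K P Q : nat -> {linear H -> H}) (u g : int -> H).

(** The power series of K in w has radius of convergence at least 1. *)
Definition subexponential (K : nat -> H -> H) : Prop :=
  forall s : R, 1 < s -> exists2 D, 0 <= D &
    forall k x, rnorm (K k x) <= D * s ^+ k * rnorm x.

Definition expbounded (mu : R) u : Prop := exists C, forall n, rnorm (u n) <= C * mu ^ n.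

(** Convolution with K followed by a translation by [a]: the operator under
    study has [a = 1] and its inverse [a = -1]. *)
Definition opconv K (a : int) u : int -> H :=
  fun n => vsum (fun k : nat => K k (u (n + a - k%:Z))).

(** Using the growth rate sqrt mu < mu leaves a geometric decay of ratio
    q = 1 / sqrt mu after division by mu^k; the ratio is the same for all
    kernels, so that decays of two kernels can be combined. *)
Lemma subexponential_rate K (mu : R) : subexponential K -> 1 < mu ->
  exists2 D, 0 <= D & forall k x,
    rnorm (K k x) <= D * ((Num.sqrt mu)^-1 ^+ k * mu ^+ k) * rnorm x.
Proof.
move=> sK mu1; have mu0 : 0 <= mu by rewrite ltW// (lt_trans _ mu1).
have s1 : 1 < Num.sqrt mu by rewrite -sqrtr1 ltr_sqrt// (lt_trans _ mu1).
have s0 : Num.sqrt mu != 0 by rewrite gt_eqF// (lt_trans _ s1).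
have [D D0 DK] := sK _ s1; exists D => // k x.
by rewrite -exprMn -{2}[mu]sqr_sqrtr// expr2 mulKf.
Qed.

Lemma rate01 (mu : R) : 1 < mu -> 0 <= (Num.sqrt mu)^-1 < 1.
Proof.
move=> mu1; have s1 : 1 < Num.sqrt mu by rewrite -sqrtr1 ltr_sqrt// (lt_trans _ mu1).
by rewrite invr_ge0 sqrtr_ge0 /= invf_lt1// (lt_trans _ s1).
Qed.

Lemma exprz_subn (mu : R) (n : int) (k : nat) : 0 < mu ->
  mu ^+ k * mu ^ (n - k%:Z) = mu ^ n.
Proof.
move=> mu0; rewrite expfzDr ?gt_eqF// mulrCA -exprnN mulfV ?mulr1//.
by rewrite expf_neq0// gt_eqF.
Qed.

Lemma opconv_term K (mu C D q : R) u (a n : int) : 0 < mu -> 0 <= q -> 0 <= D ->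
  (forall k x, rnorm (K k x) <= D * (q ^+ k * mu ^+ k) * rnorm x) ->
  (forall n, rnorm (u n) <= C * mu ^ n) ->
  forall k : nat, rnorm (K k (u (n + a - k%:Z))) <= D * C * mu ^ (n + a) * q ^+ k.
Proof.
move=> mu0 q0 D0 DK Cu k; apply: le_trans (DK _ _) _.
have DM : 0 <= D * (q ^+ k * mu ^+ k).
  by rewrite !mulr_ge0 ?exprn_ge0// ltW.
apply: le_trans (ler_wpM2l DM (Cu _)) _.
by rewrite -(exprz_subn (n + a) k mu0) le_eqVlt; apply/orP; left; apply/eqP; ring.
Qed.

Lemma opconv_lin K (mu : R) (a : int) (c : R[i]) u g : 1 < mu -> subexponential K ->
  expbounded mu u -> expbounded mu g ->
  opconv K a (c *: u + g) = c *: opconv K a u + opconv K a g.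
Proof.
move=> mu1 sK [C Cu] [E Eg]; apply/funext => n.
have mu0 : 0 < mu by apply: lt_trans mu1.
have [D D0 DK] := subexponential_rate sK mu1.
have /andP[q0 _] := rate01 mu1.
apply: etrans (vsum_linear c (rate01 mu1) (opconv_term a n mu0 q0 D0 DK Cu)
  (opconv_term a n mu0 q0 D0 DK Eg)).
rewrite /opconv; congr (limn (series _)); apply/funext => k.
by rewrite -[RHS](linearP (K k)).
Qed.

Lemma opconv_bounded K (mu : R) (a : int) : 1 < mu -> subexponential K ->
  exists2 M, 0 <= M & forall C u, (forall n, rnorm (u n) <= C * mu ^ n) ->
    forall n, rnorm (opconv K a u n) <= M * C * mu ^ n.
Proof.
move=> mu1 sK; have mu0 : 0 < mu by apply: lt_trans mu1.
have [D D0 DK] := subexponential_rate sK mu1.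
have /andP[q0 q1] := rate01 mu1.
exists (D * mu ^ a / (1 - (Num.sqrt mu)^-1)) => [|C u Cu n].
  by rewrite !mulr_ge0 ?invr_ge0 ?exprz_ge0 ?subr_ge0// ltW.
apply: le_trans (vsum_le (rate01 mu1) (opconv_term a n mu0 q0 D0 DK Cu)) _.
by rewrite expfzDr ?gt_eqF// le_eqVlt; apply/orP; left; apply/eqP; ring.
Qed.

(** The terms F j k = P_j (Q_k (u_(n-j-k))) of the iterated convolution are
    O(q^(j+k)). Over the triangle j + k < N they add up to u_n, by the
    hypothesis on the Cauchy product; the first N outer terms of the iterated
    sum differ from this triangle by N remainders of order q^N, and
    N q^N tends to 0. *)
Lemma opconv_inverse P Q (mu : R) (a b : int) u : 1 < mu -> a + b = 0 ->
  subexponential P -> subexponential Q ->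
  (forall m x, \sum_(j < m.+1) P j (Q (m - j)%N x) = if m == 0%N then x else 0) ->
  expbounded mu u -> opconv P a (opconv Q b u) = u.
Proof.
move=> mu1 ab0 sP sQ PQ [C Cu]; apply/funext => n.
have mu0 : 0 < mu by apply: lt_trans mu1.
have [D D0 DP] := subexponential_rate sP mu1.
have [E E0 EQ] := subexponential_rate sQ mu1.
have := rate01 mu1; set q := (Num.sqrt mu)^-1 in DP EQ * => q01.
have /andP[q0 q1] := q01.
have q'0 : 0 < 1 - q by rewrite subr_gt0.
apply: cvg_lim => //; apply/cvg_rnormP.
set f := fun j : nat => P j (opconv Q b u (n + a - j%:Z)).
have bound N : rnorm (series f N.+1 - u n) <=
    D * E * C * mu ^ n / (1 - q) * (N.+1%:R * q ^+ N.+1).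
  have -> : u n = \sum_(j < N.+1) \sum_(k < N.+1 - j) P j (Q k (u (n - j%:Z - k%:Z))).
    rewrite (sum_triangle (fun j k => P j (Q k (u (n - j%:Z - k%:Z))))).
    transitivity (\sum_(m < N.+1) if m == 0 :> nat then u n else 0).
      rewrite big_ord_recl /= big1 ?addr0//.
    apply: eq_bigr => m _.
    transitivity (\sum_(j < m.+1) P j (Q (m - j)%N (u (n - m%:Z)))).
      by rewrite PQ; case: eqP => // ->; rewrite subr0.
    apply: eq_bigr => j _; do 3!congr (_ _); have := ltn_ord j; lia.
  rewrite /series /= big_mkord -sumrB.
  apply: le_trans (ler_rnorm_sum _ _ _) _.
  rewrite mulrCA mulr_natl -[X in _ *+ X]card_ord -sumr_const.
  apply: ler_sum => j _.
  rewrite -linear_sum -linearB /=.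
  have jN : (j <= N.+1)%N by exact: ltnW.
  have DM : 0 <= D * (q ^+ j * mu ^+ j) by rewrite !mulr_ge0 ?exprn_ge0// ltW.
  apply: le_trans (DP _ _) _.
  have := geometric_tail q01 (opconv_term b (n + a - j%:Z) mu0 q0 E0 EQ Cu) (N.+1 - j).
  have -> : n + a - j%:Z + b = n - j%:Z by rewrite -addrA addrCA; lia.
  move=> /(ler_wpM2l DM) tail.
  apply: le_trans (le_trans _ tail) _.
    rewrite le_eqVlt; apply/orP; left; apply/eqP; congr (_ * rnorm (vsum _ - _)).
    by apply/funext => k; do 2!congr (_ _); lia.
  rewrite -[X in _ <= _ * _ ^+ X](subnKC jN) exprD -(exprz_subn n j mu0) le_eqVlt; apply/orP; left.
  by apply/eqP; ring.
have q2 : 0 <= Num.sqrt q < 1.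
  rewrite sqrtr_ge0 /= -sqrtr1 ltr_sqrt//.
(* N q^N = (N r^N) r^N with r = sqrt q, and N r^N is bounded. *)
have N0 : (fun N => D * E * C * mu ^ n / (1 - q) * (N%:R * q ^+ N)) @ \oo --> (0 : R).
  have B := cvg_geometric0 (`|D * E * C * mu ^ n / (1 - q)| / (1 - Num.sqrt q)) q2.
  apply/cvgr0Pnorm_le => e e0; move/cvgr0Pnorm_le : B => /(_ _ e0).
  apply: filterS => N; apply: le_trans.
  rewrite normrM [leRHS]ger0_norm; last first.
    case/andP: q2 => q2 /ltW; rewrite -subr_ge0 -invr_ge0 => q2'.
    by apply: mulr_ge0; [apply: mulr_ge0|apply: exprn_ge0].
  rewrite -[leRHS]mulrA ler_wpM2l// ger0_norm ?mulr_ge0 ?exprn_ge0//.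
  rewrite -{1}[q]sqr_sqrtr// expr2 exprMn mulrA ler_wpM2r ?exprn_ge0 ?sqrtr_ge0//.
  exact: natr_geometric_le.
apply/cvgr0Pnorm_le => e e0; move/cvgr0Pnorm_le : N0 => /(_ _ e0)[M _ HM].
exists M.+1 => // -[//|N] MN; rewrite ger0_norm ?rnorm_ge0//.
apply: le_trans (bound N) _; apply: le_trans (ler_norm _) (HM _ _).
exact: ltnW.
Qed.

End Kernels.

(** * Convolutions on weighted l2 spaces *)

(** Cauchy-Schwarz for the weights w: with S the weighted sum, expand
    w_i (v_i - S / W)^2 >= 0 and sum over i. *)
Lemma weighted_sqr_sum_le (R : realFieldType) (I : Type) (r : seq I)
    (w v : I -> R) (W : R) : 0 < W -> (forall i, 0 <= w i) ->
  \sum_(i <- r) w i <= W ->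
  (\sum_(i <- r) w i * v i) ^+ 2 <= W * \sum_(i <- r) w i * v i ^+ 2.
Proof.
move=> W0 w0 wW; set S := \sum_(i <- r) w i * v i.
have: \sum_(i <- r) (w i * v i *+ 2 * (S / W) - w i * (S / W) ^+ 2)
    <= \sum_(i <- r) w i * v i ^+ 2.
  apply: ler_sum => i _; rewrite -subr_ge0.
  have -> : w i * v i ^+ 2 - (w i * v i *+ 2 * (S / W) - w i * (S / W) ^+ 2) =
    w i * (v i - S / W) ^+ 2 by ring.
  by rewrite mulr_ge0 ?sqr_ge0.
rewrite sumrB -!mulr_suml sumrMnl -/S => h.
rewrite -ler_pdivrMl//; apply: le_trans h.
have SW : W^-1 * S ^+ 2 = S *+ 2 * (S / W) - W * (S / W) ^+ 2.
  by field; rewrite gt_eqF.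
by rewrite SW lerB// ler_wpM2r ?sqr_ge0.
Qed.

Section Energy.
Context {R : realType} {H : completeNormedModType R[i]}.
Implicit Types (K : nat -> {linear H -> H}) (u g : int -> H).

(** Reduces estimates of the energy to finite real sums. *)
Lemma l2_energy_leP (mu M : R) u : 0 < mu ->
  (l2_energy mu u <= M%:E)%E <->
  forall s : seq int, uniq s -> \sum_(n <- s) (rnorm (u n) * mu ^ (- n)) ^+ 2 <= M.
Proof.
move=> mu0.
have E n : rnorm (u n) ^+ 2 * mu ^ (- 2%:Z * n) = (rnorm (u n) * mu ^ (- n)) ^+ 2.
  by rewrite exprMn [(mu ^ _) ^+ 2]exprnP exprz_exp; congr (_ * _ ^ _); lia.
split=> [uM s us|uM].
- rewrite -lee_fin; apply: le_trans uM; apply: ereal_sup_ubound.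
  exists [set` s]; first by split=> //; exact: finite_seq.
  rewrite -fsbig_seq// sumEFin; congr (_%:E); apply: eq_bigr => n _; exact: E.
- apply: ge_ereal_sup => _ [F [finF _] <-].
  rewrite fsbig_finite// sumEFin lee_fin.
  under eq_bigr do rewrite E.
  exact: uM (finmap.fset_uniq _).
Qed.

Lemma l2_energy_ge0 (mu : R) u : 0 <= mu -> (0 <= l2_energy mu u)%E.
Proof.
by move=> mu0; apply: esum_ge0 => n _; rewrite lee_fin mulr_ge0 ?sqr_ge0 ?exprz_ge0.
Qed.

Lemma l2_energyE (mu : R) u : 0 <= mu -> l2 mu u ->
  l2_energy mu u = (l2_norm mu u ^+ 2)%:E.
Proof.
move=> mu0 ul; have u0 := l2_energy_ge0 u mu0.
rewrite /l2_norm sqr_sqrtr ?fine_ge0// fineK// ge0_fin_numE//.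
Qed.

Lemma l2_le_norm (mu : R) u n : 0 < mu -> l2 mu u -> rnorm (u n) <= l2_norm mu u * mu ^ n.
Proof.
move=> mu0 ul.
have : (l2_energy mu u <= (l2_norm mu u ^+ 2)%:E)%E by rewrite l2_energyE// ltW.
move=> /(l2_energy_leP _ _ mu0)/(_ [:: n] isT); rewrite big_seq1.
rewrite ler_pXn2r ?nnegrE ?sqrtr_ge0 ?mulr_ge0 ?rnorm_ge0 ?exprz_ge0 ?(ltW mu0)//.
by rewrite -invr_expz ler_pdivrMr ?exprz_gt0.
Qed.

Lemma l2_expbounded (mu : R) u : 0 < mu -> l2 mu u -> expbounded mu u.
Proof. by move=> mu0 ul; exists (l2_norm mu u) => n; exact: l2_le_norm. Qed.

(** Young's inequality. For the kernel truncated at N it follows from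
    Cauchy-Schwarz with the geometric weights w_k and from translating the
    finite index set by k; the bound does not depend on N, and N tends to
    infinity on each finite set of indices. *)
Lemma opconv_energy K (mu : R) (a : int) : 1 < mu -> subexponential K ->
  exists2 M, 0 <= M & forall u, l2 mu u ->
    (l2_energy mu (opconv K a u) <= ((M * l2_norm mu u) ^+ 2)%:E)%E.
Proof.
move=> mu1 sK; have mu0 : 0 < mu by apply: lt_trans mu1.
have [D' D'0 DK'] := subexponential_rate sK mu1.
have := rate01 mu1; set q := (Num.sqrt mu)^-1 in DK' * => q01.
have /andP[q0 q1] := q01; have q'0 : 0 < 1 - q by rewrite subr_gt0.
(* The constant is enlarged to be positive, since it is divided by below. *)
pose D := D' + 1; have D0 : 0 < D by rewrite ltr_wpDl.
have DK k x : rnorm (K k x) <= D * (q ^+ k * mu ^+ k) * rnorm x.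
  apply: le_trans (DK' k x) _; rewrite ler_wpM2r ?rnorm_ge0// ler_wpM2r ?lerDl//.
  by rewrite mulr_ge0 ?exprn_ge0// ltW.
pose kap := D * mu ^ a / (1 - q).
have kap0 : 0 < kap by rewrite !mulr_gt0 ?invr_gt0 ?exprz_gt0.
exists kap => [|u ul]; first exact: ltW.
apply/l2_energy_leP => // s us.
have uM : (l2_energy mu u <= (l2_norm mu u ^+ 2)%:E)%E by rewrite l2_energyE// ltW.
move/(l2_energy_leP _ _ mu0) : uM => uM.
have uC n : rnorm (u n) <= l2_norm mu u * mu ^ n by exact: l2_le_norm.
pose t N n := \sum_(k < N) K k (u (n + a - k%:Z)).
have tM N : \sum_(n <- s) (rnorm (t N n) * mu ^ (- n)) ^+ 2 <= (kap * l2_norm mu u) ^+ 2.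
  pose v m := rnorm (u m) * mu ^ (- m).
  pose w (k : nat) := D * mu ^ a * q ^+ k.
  have w0 k : 0 <= w k by rewrite !mulr_ge0 ?exprn_ge0 ?exprz_ge0// ltW.
  have wk : \sum_(k < N) w k <= kap.
    rewrite -mulr_sumr /kap ler_wpM2l//.
      by rewrite mulr_ge0 ?exprz_ge0// ltW.
    by have := geometric_sum_le 0 N q01; rewrite big_mkord expr0 mul1r.
  have tle n : (rnorm (t N n) * mu ^ (- n)) ^+ 2 <=
      kap * \sum_(k < N) w k * v (n + a - k%:Z) ^+ 2.
    apply: le_trans (weighted_sqr_sum_le _ kap0 (fun k : 'I_N => w0 k) wk).
    rewrite ler_pXn2r ?nnegrE.
    - apply: le_trans (ler_wpM2r _ (ler_rnorm_sum _ _ _)) _.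
        by rewrite exprz_ge0// ltW.
      rewrite mulr_suml; apply: ler_sum => k _.
      apply: le_trans (ler_wpM2r _ (DK _ _)) _; first by rewrite exprz_ge0// ltW.
      rewrite /w /v le_eqVlt; apply/orP; left; apply/eqP.
      have -> : - (n + a - k%:Z) = - n - a + k%:Z by ring.
      rewrite !expfzDr ?gt_eqF// -!invr_expz -exprnP.
      by field; rewrite !expfz_neq0 ?gt_eqF.
    - by [].
    - by rewrite mulr_ge0 ?rnorm_ge0 ?exprz_ge0// ltW.
    - apply: sumr_ge0 => k _; rewrite mulr_ge0// /v.
      by rewrite mulr_ge0 ?rnorm_ge0 ?exprz_ge0// ltW.
  apply: le_trans (ler_sum _ (fun n _ => tle n)) _.
  rewrite -mulr_sumr exchange_big /= exprMn expr2 -[leRHS]mulrA ler_wpM2l ?(ltW kap0)//.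
  apply: (@le_trans _ _ (\sum_(k < N) w k * l2_norm mu u ^+ 2)); last first.
    by rewrite -mulr_suml ler_wpM2r ?sqr_ge0.
  apply: ler_sum => k _; rewrite -mulr_sumr ler_wpM2l//.
  have := uM [seq n + a - k%:Z | n <- s]; rewrite big_map; apply.
  by rewrite map_inj_uniq// => x y; lia.
have lim : (fun N => \sum_(n <- s) (rnorm (t N n) * mu ^ (- n)) ^+ 2) @ \oo -->
    \sum_(n <- s) (rnorm (opconv K a u n) * mu ^ (- n)) ^+ 2.
  apply: cvg_big => [|n _]; first exact: add_continuous.
  suff cv : (fun N => rnorm (t N n) * mu ^ (- n)) @ \oo --> rnorm (opconv K a u n) * mu ^ (- n).
    by rewrite expr2; under eq_fun do rewrite expr2; exact: cvgM.
  apply: cvgMr_tmp.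
  have tl := geometric_tail q01 (opconv_term a n mu0 q0 (ltW D0) DK uC).
  apply/cvgrPdist_le => e e0.
  have /cvgr0Pnorm_le/(_ _ e0) := cvg_geometric0 (D * l2_norm mu u * mu ^ (n + a) / (1 - q)) q01.
  apply: filterS => N; apply: le_trans.
  apply: le_trans (ler_dist_rnorm _ _) (le_trans (tl N) _).
  by rewrite mulrAC ler_norm.
by apply: (cvgr_to_le lim); exact: nearW.
Qed.

Lemma opconv_l2_bounded_operator K (mu : R) (a : int) : 1 < mu -> subexponential K ->
  l2_bounded_operator mu (opconv K a).
Proof.
move=> mu1 sK; have mu0 : 0 < mu by apply: lt_trans mu1.
have [M M0 KM] := opconv_energy a mu1 sK.
split.
- by move=> u ul; apply: le_lt_trans (KM u ul) (ltry _).
- move=> c u g ul gl; apply: (opconv_lin _ _ mu1) => //; exact: l2_expbounded.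
- exists M => u ul; have Kul : l2 mu (opconv K a u) by apply: le_lt_trans (KM u ul) (ltry _).
  have := KM u ul; rewrite l2_energyE ?(ltW mu0)// lee_fin.
  by rewrite ler_pXn2r ?nnegrE ?mulr_ge0 ?sqrtr_ge0.
Qed.

Lemma opconv_causal K (mu : R) (a : int) : a <= 0 -> causal mu (opconv K a).
Proof.
move=> a0 b g _ gb n; rewrite /spt /=; apply: contra_notP => /negP bn.
rewrite /opconv (_ : (fun k : nat => _) = (fun=> 0)).
  by apply: cvg_lim => //; apply: cvg_near_cst; apply: nearW => N; rewrite /series /= big1.
apply/funext => k; have [->|gk] := pselect (g (n + a - k%:Z) = 0).
  by rewrite linear0.
by have := gb _ gk; move: bn => /=; lia.
Qed.

End Energy.

(** * The principle of uniform boundedness *)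

Section UniformBoundedness.
Context {R : realType} {H : completeNormedModType R[i]}.
Variable T : nat -> {linear H -> H}.
Hypothesis Tbounded : forall n, exists C, forall x, rnorm (T n x) <= C * rnorm x.

(** Every ball (center and radius in [p]) contains a smaller one on which some
    T_n exceeds k. Pick n with T_n so large that a vector y of norm p.2 / 2
    has |T_n y| >= k + 1; since 2 T_n y = T_n (x + y) - T_n (x - y), one of
    x + y and x - y is a suitable center, and boundedness of T_n gives the
    radius. *)
Lemma gliding_hump_step :
  (forall M, exists n x, M * rnorm x < rnorm (T n x)) ->
  forall (k : nat) (p : H * R), exists p' : H * R, 0 < p.2 ->
    [/\ 0 < p'.2, p'.2 <= p.2 / 2, rnorm (p'.1 - p.1) <= p.2 / 2 &
        exists n, forall z, rnorm (z - p'.1) <= p'.2 -> k%:R <= rnorm (T n z)].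
Proof.
move=> unb k [x r]; have [r0|r0] := ltP 0 r; last first.
  by exists (x, r) => /=; rewrite ltNge r0.
have [n [y0 Ty0]] := unb ((k%:R + 1) / (r / 2)).
have y0_gt0 : 0 < rnorm y0.
  rewrite lt_neqAle rnorm_ge0 andbT; apply/eqP => /esym/rnorm_eq0 y00.
  by move: Ty0; rewrite y00 linear0 rnorm0 mulr0 ltxx.
(* y rescales y0 to norm r / 2. *)
pose c := r / 2 / rnorm y0.
have c0 : 0 < c by rewrite !divr_gt0.
pose y := (c%:C)%C *: y0.
have cE : rnorm ((c%:C)%C : R[i]^o) = c.
  by apply/(@complexI R); rewrite -rnorm_scalar ger0_norm// ler0c ltW.
have yr : rnorm y = r / 2 by rewrite rnormZ cE divfK// gt_eqF.
have Ty : k%:R + 1 <= rnorm (T n y).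
  rewrite linearZ rnormZ cE /c mulrAC ler_pdivlMr//.
  apply: le_trans (ler_wpM2l _ (ltW Ty0)); last by rewrite ltW// divr_gt0.
  by rewrite le_eqVlt; apply/orP; left; apply/eqP; field; rewrite gt_eqF.
have [y' [y'r Ty']] : exists y', rnorm y' = r / 2 /\ k%:R + 1 <= rnorm (T n (x + y')).
  have [le1|gt1] := leP (k%:R + 1) (rnorm (T n (x + y))); first by exists y.
  exists (- y); split; first by rewrite rnormN.
  have := ler_rnormB (T n (x + y)) (T n (x - y)).
  have -> : T n (x + y) - T n (x - y) = 2 *: T n y.
    by rewrite -linearB opprD opprK addrACA subrr add0r linearD scaler_nat.
  rewrite rnormZ (_ : rnorm (2 : R[i]^o) = 2); last first.
    by apply/(@complexI R); rewrite -rnorm_scalar ger0_norm ?ler0n// rmorph_nat.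
  lra.
have [C TC] := Tbounded n.
pose r' := Num.min (r / 2) (`|C| + 1)^-1.
have r'0 : 0 < r' by rewrite lt_min divr_gt0//= invr_gt0 ltr_wpDl.
exists (x + y', r') => _ /=; split => //.
- by rewrite ge_min lexx.
- by rewrite addrAC subrr add0r y'r.
- exists n => z zr; have := ler_dist_rnorm (T n z) (T n (x + y')).
  rewrite -(linearB (T n)) => /ler_normlP[h _].
  suff : rnorm (T n (z - (x + y'))) <= 1 by lra.
  apply: le_trans (TC _) _; apply: (@le_trans _ _ ((`|C| + 1) * r')).
    apply: (@le_trans _ _ ((`|C| + 1) * rnorm (z - (x + y')))).
      by rewrite ler_wpM2r ?rnorm_ge0// (le_trans (ler_norm _))// lerDl.
    by rewrite ler_wpM2l// addr_ge0.
  by rewrite -ler_pdivlMl ?ltr_wpDl// mulr1 ge_min lexx orbT.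
Qed.

(** Otherwise the gliding hump step, iterated, yields nested balls shrinking to
    a point at which the T_n are unbounded. *)
Lemma uniform_boundedness : (forall x, exists M, forall n, rnorm (T n x) <= M) ->
  exists2 M, 0 <= M & forall n x, rnorm (T n x) <= M * rnorm x.
Proof.
move=> ptb; apply: contrapT => nub.
have unb M : exists n x, M * rnorm x < rnorm (T n x).
  apply: contrapT => no; apply: nub; exists `|M| => // n x.
  rewrite leNgt; apply/negP => h; apply: no; exists n, x; apply: le_lt_trans h.
  by rewrite ler_wpM2r ?rnorm_ge0// ler_norm.
have /choice[F FP] : forall kp : nat * (H * R), exists p' : H * R, _ :=
  fun kp => gliding_hump_step unb kp.1 kp.2.
pose fix st k := if k is j.+1 then F (j, st j) else (0 : H, 1 : R).
pose x k := (st k).1; pose r k := (st k).2.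
have rgt0 k : 0 < r k by elim: k => [|k IH] //; case: (FP (k, st k) IH).
have step k : [/\ 0 < r k.+1, r k.+1 <= r k / 2, rnorm (x k.+1 - x k) <= r k / 2 &
    exists n, forall z, rnorm (z - x k.+1) <= r k.+1 -> k%:R <= rnorm (T n z)].
  exact: FP (k, st k) (rgt0 k).
have rle k : r k <= 2^-1 ^+ k.
  elim: k => [|k IH]; first by rewrite expr0.
  by have [_ + _ _] := step k; rewrite exprS; lra.
have nested k i : rnorm (x (k + i)%N - x k) + r (k + i)%N <= r k.
  elim: i => [|i IH]; first by rewrite addn0 subrr rnorm0 add0r.
  rewrite addnS; have [_ h1 h2 _] := step (k + i)%N.
  have := ler_rnormD (x (k + i).+1 - x (k + i)%N) (x (k + i)%N - x k).
  by rewrite subrKA; lra.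
have half01 : 0 <= (2^-1 : R) < 1 by apply/andP; split; lra.
have xsum n : series (fun k => x k.+1 - x k) n = x n.
  by rewrite /series /= telescope_sumr// /x /= subr0.
have /cvg_ex[L xL] : cvgn (series (fun k => x k.+1 - x k)).
  apply: (@geometric_cvg _ _ _ 1 2^-1 half01) => k.
  by have [_ _ h _] := step k; have := rle k; have := rgt0 k; rewrite mul1r; lra.
rewrite (funext xsum) in xL.
have Lk k : rnorm (L - x k) <= r k.
  have cv : (fun n => rnorm (x n - x k)) @ \oo --> rnorm (L - x k).
    apply/cvgrPdist_le => e e0; move/cvg_rnormP/cvgr0Pnorm_le : xL => /(_ _ e0).
    apply: filterS => n; rewrite ger0_norm ?rnorm_ge0//; apply: le_trans.
    by apply: le_trans (ler_dist_rnorm _ _) _; rewrite opprB addrA subrK rnormB.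
  apply: (cvgr_to_le cv); exists k => // n /= kn.
  have := nested k (n - k)%N; rewrite subnKC//; have := rgt0 n; lra.
have [M LM] := ptb L.
have [_ _ _ [n Tn]] := step (Num.truncn M).+1.
have := le_trans (Tn L (Lk _)) (LM n).
by rewrite leNgt truncnS_gt.
Qed.

End UniformBoundedness.

(** * Scalar power series and the coefficients of (1 - w)^a *)

Section ScalarConvolution.
Context {K : comNzRingType} {V : lmodType K}.
Implicit Types (a b : nat -> K) (v : nat -> V).

Definition sconv a v (n : nat) : V := \sum_(j < n.+1) a j *: v (n - j)%N.

Lemma sconv_rev a v n : sconv a v n = \sum_(j < n.+1) a (n - j)%N *: v j.
Proof.
rewrite /sconv (reindex_inj rev_ord_inj) /=; apply: eq_bigr => j _.
by rewrite subSS subKn// -ltnS.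
Qed.
End ScalarConvolution.

Definition cauchy_prod {K : comNzRingType} (a b : nat -> K) : nat -> K :=
  sconv a (b : nat -> K^o).

Definition unit_seq {K : comNzRingType} : nat -> K := fun n => (n == 0%N)%:R.

Section ScalarConvolutionTheory.
Context {K : comNzRingType} {V : lmodType K}.
Implicit Types (a b : nat -> K) (v : nat -> V).

Lemma cauchy_prodC a b : cauchy_prod a b = cauchy_prod b a.
Proof.
apply/funext => n; rewrite /cauchy_prod sconv_rev; apply: eq_bigr => j _.
exact: mulrC.
Qed.

Lemma sconvA a b v : sconv a (sconv b v) = sconv (cauchy_prod a b) v.
Proof.
apply/funext => n; rewrite /sconv.
transitivity (\sum_(j < n.+1) \sum_(k < n.+1 - j) (a j * b k) *: v (n - j - k)%N).
  apply: eq_bigr => j _; rewrite scaler_sumr -subSn -1?ltnS//.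
  by apply: eq_bigr => k _; rewrite scalerA.
rewrite (sum_triangle (fun j k => (a j * b k) *: v (n - j - k)%N)).
apply: eq_bigr => m _.
rewrite /cauchy_prod /sconv scaler_suml; apply: eq_bigr => j _.
by rewrite /= -subnDA subnKC// -ltnS.
Qed.

Lemma sconv_unit v : sconv unit_seq v = v.
Proof.
apply/funext => n; rewrite /sconv big_ord_recl /= subn0 scale1r big1 ?addr0//.
by move=> j _; rewrite scale0r.
Qed.

End ScalarConvolutionTheory.

Section FractionalCoefficients.
Context {K : numFieldType}.
Implicit Types a b : K.

(** The coefficients of (1 - w)^a. *)
Definition fcoef a (k : nat) : K := (-1) ^+ k * gbinom a k.

Lemma fcoef0 a : fcoef a 0 = 1.
Proof. by rewrite /fcoef /gbinom big_ord0 fact0 expr0 mul1r divr1. Qed.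

Lemma fcoefS a k : k.+1%:R * fcoef a k.+1 = (k%:R - a) * fcoef a k.
Proof.
rewrite /fcoef /gbinom big_ord_recr /= factS natrM exprS.
have k0 : k`!%:R != 0 :> K by rewrite pnatr_eq0 -lt0n fact_gt0.
have k1 : k.+1%:R != 0 :> K by rewrite pnatr_eq0.
by field; rewrite k0 nat1r.
Qed.

(** The Chu-Vandermonde identity, (1 - w)^a (1 - w)^b = (1 - w)^(a + b): both
    sides satisfy the recurrence (n+1) s_(n+1) = (n - a - b) s_n, as is seen on
    the left by splitting the factor n + 1 as j + (n + 1 - j) in the j-th
    term. *)
Lemma fcoefD a b : cauchy_prod (fcoef a) (fcoef b) = fcoef (a + b).
Proof.
apply/funext; elim=> [|n IH].
  by rewrite /cauchy_prod /sconv big_ord1 !fcoef0 /= scale1r.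
have n0 : n.+1%:R != 0 :> K by rewrite pnatr_eq0.
apply: (mulfI n0); rewrite fcoefS -IH /cauchy_prod /sconv /=.
transitivity (\sum_(j < n.+2) (j%:R * fcoef a j * fcoef b (n.+1 - j)) +
   \sum_(j < n.+2) (fcoef a j * ((n.+1 - j)%:R * fcoef b (n.+1 - j)))).
  rewrite -big_split mulr_sumr; apply: eq_bigr => j _ /=.
  by rewrite natrB -1?ltnS// /GRing.scale /=; ring.
rewrite [X in X + _]big_ord_recl mul0r mul0r add0r.
rewrite [X in _ + X]big_ord_recr /= subnn mul0r mulr0 addr0.
rewrite mulr_sumr -big_split; apply: eq_bigr => j _ /=.
have jn : (j <= n)%N by rewrite -ltnS.
rewrite /bump /= add1n subSS subSn// !fcoefS natrB// /GRing.scale /=; ring.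
Qed.

Lemma fcoef1 k : fcoef (1 : K) k.+2 = 0.
Proof.
elim: k => [|k IH].
  have := fcoefS (1 : K) 1; rewrite subrr mul0r => /eqP.
  by rewrite mulf_eq0 pnatr_eq0 /= => /eqP.
by have := fcoefS (1 : K) k.+2; rewrite IH mulr0 => /eqP; rewrite mulf_eq0 pnatr_eq0 /= => /eqP.
Qed.

(** The ratio of successive coefficients is (k - a) / (k + 1), of modulus at
    most 1. *)
Lemma fcoef_norm_le1 a k : 0 <= a <= 1 -> `|fcoef a k| <= 1.
Proof.
move=> /andP[a0 a1]; elim: k => [|k IH]; first by rewrite fcoef0 normr1.
have k0 : 0 < k.+1%:R :> K by rewrite ltr0n.
rewrite -(ler_pM2l k0) -[X in X * _](ger0_norm (ltW k0)) -normrM fcoefS normrM.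
rewrite mulr1; apply: le_trans (ler_piMr (normr_ge0 _) IH) _.
apply: le_trans (ler_normB _ _) _.
by rewrite !ger0_norm// -natr1 lerD2l.
Qed.

(** The partial sums of the coefficients of (1 - w)^a, that is the coefficients
    of (1 - w)^(a - 1). *)
Definition fcoef_sum a : nat -> K := cauchy_prod (fcoef a) (fun=> 1).

(** (1 - w)^(1 - a) (1 - w)^a = 1 - w, and multiplying by 1 - w undoes the
    summation. *)
Lemma fcoef_sum_inv a : cauchy_prod (fcoef (1 - a)) (fcoef_sum a) = unit_seq.
Proof.
rewrite /fcoef_sum {1 2}/cauchy_prod sconvA fcoefD subrK.
apply/funext => -[|n]; rewrite /sconv /unit_seq /=.
  by rewrite big_ord1 fcoef0 /= scale1r.
rewrite big_ord_recl big_ord_recl big1 => [|j _]; last by rewrite fcoef1 scale0r.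
rewrite /= fcoef0 addr0 scale1r.
have := fcoefS (1 : K) 0; rewrite mul1r fcoef0 mulr1 sub0r => ->.
by rewrite scaleN1r subrr.
Qed.

Lemma fcoef_sum_norm_le a k : 0 <= a <= 1 -> `|fcoef_sum a k| <= 2 ^+ k.
Proof.
move=> a01; apply: le_trans (ler_norm_sum _ _ _) _.
apply: (@le_trans _ _ (\sum_(j < k.+1) 1)).
  by apply: ler_sum => j _; rewrite normrM normr1 mulr1 fcoef_norm_le1.
by rewrite sumr_const card_ord -natrX ler_nat ltn_expl.
Qed.

End FractionalCoefficients.

(** * The resolvent sequence *)

Section Resolvent.
Context {K : comNzRingType} {V : lmodType K}.
Variables (A : {linear V -> V}) (c : nat -> K).

(** The recursion Q_(n+1) = A Q_n - sum over i <= n of c_(n+1-i) Q_i refers to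
    all earlier values, so [resolvent_upto n] tabulates Q_0, ..., Q_n. *)
Fixpoint resolvent_upto (n : nat) : nat -> V -> V :=
  match n with
  | 0%N => fun _ x => x
  | m.+1 => fun k =>
      if (k <= m)%N then resolvent_upto m k
      else fun x => A (resolvent_upto m m x) -
                    \sum_(i < m.+1) c (m.+1 - i)%N *: resolvent_upto m i x
  end.

(** The coefficients of the formal inverse of c(w) - w A, if c has constant
    term 1. *)
Definition resolvent (n : nat) : V -> V := resolvent_upto n n.

Lemma resolvent_upto_stable n k : (k <= n)%N -> resolvent_upto n k = resolvent k.
Proof.
elim: n => [|n IH] kn; first by move: kn; rewrite leqn0 => /eqP ->.
by case: (ltngtP k n.+1) kn => // [kn|->] _ //=; rewrite -ltnS kn IH.
Qed.

Lemma resolventS n x : resolvent n.+1 x =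
  A (resolvent n x) - \sum_(i < n.+1) c (n.+1 - i)%N *: resolvent i x.
Proof.
rewrite {1}/resolvent /= ltnn; congr (_ - _); apply: eq_bigr => i _.
by rewrite resolvent_upto_stable// -ltnS.
Qed.

Lemma resolvent_linear n : linear (resolvent n).
Proof.
elim/ltn_ind: n => -[|n] IH //= a x y.
rewrite !resolventS IH// linearP scalerBr addrACA -opprD; congr (_ - _).
rewrite scaler_sumr -big_split; apply: eq_bigr => i _ /=.
by rewrite IH// scalerDr !scalerA mulrC.
Qed.

HB.instance Definition _ n :=
  GRing.isLinear.Build K V V *:%R (resolvent n) (resolvent_linear n).

Lemma resolvent_comm n x : resolvent n (A x) = A (resolvent n x).
Proof.
elim/ltn_ind: n => -[|n] IH //.
rewrite !resolventS (linearB A) (linear_sum A) IH//; congr (_ - _).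
by apply: eq_bigr => i _; rewrite linearZ IH.
Qed.

Hypothesis c0 : c 0%N = 1.

(** The identity c(w) Q(w) x = x + w A Q(w) x. *)
Lemma sconv_resolvent x :
  sconv c (fun n => resolvent n x) =
  fun n => if n is m.+1 then A (resolvent m x) else x.
Proof.
apply/funext => -[|n]; first by rewrite /sconv big_ord1 c0 scale1r.
rewrite sconv_rev big_ord_recr /= subnn c0 scale1r resolventS addrC subrK.
by [].
Qed.

(** The coefficients of c(w) - w A. *)
Definition pencil (n : nat) (x : V) : V := c n *: x - (if n == 1%N then A x else 0).

Lemma pencil_linear n : linear (pencil n).
Proof.
move=> a x y; rewrite /pencil scalerBr addrACA -opprD scalerDr !scalerA mulrC.
by case: eqP => _; [rewrite linearP | rewrite scaler0 addr0].
Qed.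

HB.instance Definition _ n :=
  GRing.isLinear.Build K V V *:%R (pencil n) (pencil_linear n).

Lemma pencil_resolvent m x :
  \sum_(j < m.+1) pencil j (resolvent (m - j) x) = if m == 0%N then x else 0.
Proof.
under eq_bigr do rewrite /pencil.
rewrite sumrB -[X in X - _]/(sconv c (fun n => resolvent n x) m) sconv_resolvent.
case: m => [|m]; first by rewrite big_ord1 subr0.
by rewrite !big_ord_recl /= subSS subn0 big1 ?addr0 ?add0r ?subrr.
Qed.

(** The left inverse is the right inverse read backwards, since the
    coefficients commute. *)
Lemma resolvent_pencil m x :
  \sum_(j < m.+1) resolvent j (pencil (m - j)%N x) = if m == 0%N then x else 0.
Proof.
rewrite -[RHS](pencil_resolvent m x) [RHS](reindex_inj rev_ord_inj) /=.
apply: eq_bigr => j _; rewrite subSS subKn -1?ltnS//.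
rewrite /pencil linearB linearZ /=; congr (_ - _).
by case: eqP => _; rewrite ?resolvent_comm ?linear0.
Qed.

(** For u = b * Q x, the previous identity multiplied by b(w) reads
    c(w) u = w A u + b(w) x: the solution with forcing b x. *)
Lemma sconv_solution (b : nat -> K) x n :
  sconv c (sconv b (fun n => resolvent n x)) n =
  (if n is m.+1 then A (sconv b (fun n => resolvent n x) m) else 0) + b n *: x.
Proof.
rewrite sconvA cauchy_prodC -sconvA sconv_resolvent.
case: n => [|n]; first by rewrite /sconv big_ord1 add0r.
rewrite {1}/sconv big_ord_recr /= subnn; congr (_ + _).
rewrite /sconv linear_sum; apply: eq_bigr => j _.
by rewrite subSn -1?ltnS// linearZ.
Qed.

End Resolvent.

Section Bounds.
Context {R : realType} {H : completeNormedModType R[i]}.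
Variables (A : {linear H -> H}) (c : nat -> R[i]).
Hypothesis c1 : forall k, `|c k| <= 1.
Variable a : R.
Hypothesis a0 : 0 <= a.
Hypothesis Aa : forall x, rnorm (A x) <= a * rnorm x.

Let rc1 k : rnorm (c k : R[i]^o) <= 1.
Proof. by rewrite -lecR -rnorm_scalar c1. Qed.

Lemma pencil_subexponential : subexponential (fun n => pencil A c n).
Proof.
move=> s s1; exists (1 + a); first by rewrite addr_ge0.
move=> k x; rewrite /pencil; apply: le_trans (ler_rnormB _ _) _.
apply: (@le_trans _ _ ((1 + a) * rnorm x)).
  rewrite mulrDl rnormZ lerD ?ler_wpM2r ?rnorm_ge0//.
  by case: eqP => _ //; rewrite rnorm0 mulr_ge0 ?rnorm_ge0.
rewrite ler_wpM2r ?rnorm_ge0// ler_peMr ?addr_ge0// exprn_ege1// ltW//.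
Qed.

(** The base a + 2 absorbs both the norm bound a of A and the geometric sum
    of the earlier terms, which is at most twice its last term. *)
Lemma resolvent_exp_bound n x : rnorm (resolvent A c n x) <= (a + 2) ^+ n * rnorm x.
Proof.
elim/ltn_ind: n => -[|n] IH; first by rewrite expr0 mul1r.
rewrite resolventS; apply: le_trans (ler_rnormB _ _) _.
have IHn := IH n (ltnSn n).
apply: le_trans (lerD (le_trans (Aa _) (ler_wpM2l a0 IHn)) (ler_rnorm_sum _ _ _)) _.
have geo : forall m, \sum_(i < m.+1) (a + 2) ^+ i <= 2 * (a + 2) ^+ m.
  elim=> [|m IHm]; first by rewrite big_ord1 expr0 mulr1 ler1n.
  rewrite big_ord_recr /= exprS.
  have h : 0 <= a * (a + 2) ^+ m by rewrite mulr_ge0// exprn_ge0// addr_ge0.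
  by move: IHm h; set y := _ ^+ m; set z := \sum_(_ < _) _ => IHm h; nra.
have : \sum_(i < n.+1) rnorm (c (n.+1 - i)%N *: resolvent A c i x) <=
   2 * (a + 2) ^+ n * rnorm x.
  apply: le_trans (ler_wpM2r (rnorm_ge0 _) (geo n)); rewrite mulr_suml.
  apply: ler_sum => i _; rewrite rnormZ.
  by apply: le_trans (ler_piMl (rnorm_ge0 _) (rc1 _)) (IH _ _).
move=> /(lerD (lexx _)) h; apply: le_trans (h _) _.
by rewrite exprS -subr_ge0 le_eqVlt; apply/orP; left; apply/eqP; ring.
Qed.

Lemma sconv_resolvent_exp_bound (b : nat -> R[i]) n x :
  (forall k, `|b k| <= 2 ^+ k) ->
  rnorm (sconv b (fun n => resolvent A c n x) n) <= (2 * (a + 2)) ^+ n * rnorm x.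
Proof.
move=> b2; apply: le_trans (ler_rnorm_sum _ _ _) _.
have rb2 k : rnorm (b k : R[i]^o) <= 2 ^+ k.
  by rewrite -lecR -rnorm_scalar rmorphXn rmorph_nat b2.
apply: (@le_trans _ _ (\sum_(j < n.+1) (a + 2) ^+ n * rnorm x)).
  apply: ler_sum => j _; rewrite rnormZ.
  apply: le_trans (ler_wpM2l (rnorm_ge0 _) (resolvent_exp_bound _ _)) _.
  rewrite mulrA ler_wpM2r ?rnorm_ge0//.
  have jn : (j <= n)%N by rewrite -ltnS.
  rewrite -[X in _ <= _ ^+ X](subnKC jn) exprD ler_wpM2r ?exprn_ge0 ?addr_ge0//.
  apply: le_trans (rb2 j) _; rewrite lerXn2r ?nnegrE ?addr_ge0// lerDr//.
rewrite sumr_const card_ord -[leLHS]mulr_natl mulrA exprMn ler_wpM2r ?rnorm_ge0//.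
rewrite ler_wpM2r ?exprn_ge0 ?addr_ge0// -natrX ler_nat ltn_expl//.
Qed.

End Bounds.

(** * Consequences of asymptotic stability *)

Lemma uniq_sum_le (R : realDomainType) (F : int -> R) (M : R) (s : seq int) : uniq s ->
  (forall n, 0 <= F n) -> (forall n, n < 0 -> F n = 0) ->
  (forall N, \sum_(k < N) F k%:Z <= M) -> \sum_(n <- s) F n <= M.
Proof.
move=> us F0 Fneg FM.
pose N := (\max_(n <- s) absz n).+1.
pose t := [seq Posz k | k <- iota 0 N].
have ut : uniq t by rewrite map_inj_uniq ?iota_uniq// => x y [].
have sE : \sum_(n <- s) F n = \sum_(n <- s | n \in t) F n.
  rewrite [RHS]big_mkcond /=; apply: eq_big_seq => n ns; case: ifPn => // nt.
  apply: Fneg; rewrite ltNge; apply: contra nt => n0; apply/mapP; exists (absz n); last by lia.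
  by rewrite mem_iota /= add0n ltnS leq_bigmax_seq.
rewrite sE; apply: le_trans (FM N).
have -> : \sum_(k < N) F k%:Z = \sum_(n <- t) F n.
  by rewrite big_map -(big_mkord predT (fun k => F k%:Z)) /index_iota subn0.
rewrite -big_filter (perm_big [seq n <- t | n \in s]).
  rewrite big_filter big_mkcond; apply: ler_sum => n _; case: ifP => _ //.
apply: uniq_perm; rewrite ?filter_uniq// => n; rewrite !mem_filter andbC.
by [].
Qed.

Section Extension.
Context {R : realType} {H : completeNormedModType R[i]}.
Implicit Types (v : nat -> H) (u : int -> H).

Definition zero_ext v : int -> H := fun n => if n is Posz m then v m else 0.

Lemma vsum_finite (f : nat -> H) (M : nat) :
  (forall k, (M <= k)%N -> f k = 0) -> vsum f = \sum_(k < M) f k.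
Proof.
move=> f0; apply: cvg_lim => //; apply: cvg_near_cst; exists M => // n /= Mn.
rewrite /series /= (@big_cat_nat _ _ _ M)//= big_mkord [X in _ + X]big_nat_cond.
by rewrite [X in _ + X]big1 ?addr0// => k /andP[/andP[Mk _] _]; exact: f0.
Qed.

Lemma frac_diff_zero_ext (a : R[i]) v : frac_diff a (zero_ext v) = zero_ext (sconv (fcoef a) v).
Proof.
apply/funext => -[m|m]; rewrite /frac_diff.
- rewrite (@vsum_finite _ m.+1) => [|k mk]; last first.
    have [j ->] : exists j, m%:Z - k%:Z = Negz j by exists (k - m.+1)%N; lia.
    by rewrite /= scaler0.
  apply: eq_bigr => k _; rewrite subzn//; exact: ltn_ord k.
- rewrite (@vsum_finite _ 0) ?big_ord0// => k _.
  have [j ->] : exists j, Negz m - k%:Z = Negz j by exists (k + m)%N; lia.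
  by rewrite /= scaler0.
Qed.

Lemma frac_diff_shift (a : R[i]) u : frac_diff a (Defs.shift u) = Defs.shift (frac_diff a u).
Proof.
apply/funext => n; rewrite /frac_diff /Defs.shift; congr (limn (series _)).
by apply/funext => k; rewrite addrAC.
Qed.

Lemma zero_ext_l2 (C D rho : R) v : 0 < D -> D < rho ->
  (forall n, rnorm (v n) <= C * D ^+ n) -> l2 rho (zero_ext v).
Proof.
move=> D0 Drho vC; have rho0 : 0 < rho by apply: lt_trans Drho.
have q01 : 0 <= D / rho < 1 by rewrite divr_ge0 ?(ltW D0) ?(ltW rho0)//= ltr_pdivrMr// mul1r.
suff : (l2_energy rho (zero_ext v) <= (C ^+ 2 / (1 - D / rho))%:E)%E.
  by move=> h; apply: le_lt_trans h (ltry _).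
apply/l2_energy_leP => // s us; apply: uniq_sum_le => //.
- by move=> n; exact: sqr_ge0.
- by case=> // n _; rewrite /= rnorm0 mul0r expr0n.
move=> N; apply: (@le_trans _ _ (\sum_(k < N) C ^+ 2 * (D / rho) ^+ k)); last first.
  rewrite -mulr_sumr ler_wpM2l ?sqr_ge0//.
  by have := geometric_sum_le 0 N q01; rewrite big_mkord expr0 mul1r.
apply: ler_sum => k _ /=; have /andP[q0 q1] := q01.
apply: (@le_trans _ _ ((C * (D / rho) ^+ k) ^+ 2)).
  rewrite lerXn2r ?nnegrE.
  - by [].
  - by rewrite mulr_ge0 ?rnorm_ge0 ?exprz_ge0// ltW.
  - rewrite mulr_ge0 ?exprn_ge0//.
    by have := vC 0%N; rewrite expr0 mulr1; apply: le_trans; exact: rnorm_ge0.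
  - rewrite -exprnN exprMn -exprVn mulrA ler_wpM2r ?exprn_ge0 ?invr_ge0 ?(ltW rho0)//.
rewrite exprMn ler_wpM2l ?sqr_ge0// expr2 ler_piMl ?exprn_ge0// exprn_ile1//.
exact: ltW.
Qed.

Lemma delta_zero_ext (x : H) : Defs.shift (zero_ext (fun n => unit_seq n *: x)) = delta (-1) x.
Proof.
apply/funext => -[n|[|n]]; rewrite /Defs.shift /delta /=.
- by rewrite addn1 scale0r.
- by rewrite scale1r.
- by [].
Qed.

Lemma chi_zero_ext (x : H) : chi_ge (-1) x = Defs.shift (zero_ext (fun=> x)).
Proof.
apply/funext => -[n|[|n]]; rewrite /Defs.shift /chi_ge //=.
Qed.

End Extension.

Section Stability.
Context {R : realType} {H : completeNormedModType R[i]}.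
Variables (A : {linear H -> H}) (a : R) (alpha : R).
Hypothesis a0 : 0 <= a.
Hypothesis Aa : forall x, rnorm (A x) <= a * rnorm x.
Hypothesis alpha01 : 0 < alpha < 1.

Let al : R[i] := (alpha%:C)%C.
Let c := fcoef al.

Let al01 : 0 <= al <= 1.
Proof. by case/andP: alpha01 => h1 h2; rewrite !lecR !ltW. Qed.

Let c0 : c 0%N = 1. Proof. exact: fcoef0. Qed.
Let c1 k : `|c k| <= 1. Proof. exact: fcoef_norm_le1. Qed.

(** The linear maps to which uniform boundedness is applied. *)
Definition solution_map (b : nat -> R[i]) (n : nat) (x : H) : H :=
  sconv b (fun n => resolvent A c n x) n.

Lemma solution_map_linear b n : linear (solution_map b n).
Proof.
move=> k x y; rewrite /solution_map /sconv scaler_sumr -big_split.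
by apply: eq_bigr => j _; rewrite linearP scalerDr !scalerA mulrC.
Qed.

HB.instance Definition _ b n := GRing.isLinear.Build R[i] H H *:%R
  (solution_map b n) (solution_map_linear b n).

Lemma solution_map_equation b x :
  Defs.shift (frac_diff al (zero_ext (solution_map b ^~ x))) =
  A \o zero_ext (solution_map b ^~ x) + Defs.shift (zero_ext (fun n => b n *: x)).
Proof.
rewrite frac_diff_zero_ext; apply/funext => -[n|[|n]]; rewrite /Defs.shift.
- rewrite addrC -[1 + n%:Z]/(n.+1%:Z) [LHS](sconv_solution A c0) -addn1.
  by [].
- by rewrite [LHS](sconv_solution A c0) -(linear0 A).
- by rewrite -[RHS]/(A 0 + 0) linear0 addr0.
Qed.

Lemma RL_solution_map x : RL_solution al A x (zero_ext (solution_map unit_seq ^~ x)).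
Proof. by rewrite /RL_solution solution_map_equation delta_zero_ext. Qed.

Lemma Caputo_solution_map x :
  Caputo_solution al A x (zero_ext (solution_map (fcoef_sum al) ^~ x)).
Proof.
rewrite /Caputo_solution solution_map_equation chi_zero_ext frac_diff_shift frac_diff_zero_ext.
congr (_ + Defs.shift (zero_ext _)); apply/funext => n.
rewrite /fcoef_sum /cauchy_prod /sconv scaler_suml; apply: eq_bigr => j _.
by congr (_ *: _); exact: mulr1.
Qed.

(** The a priori exponential bound puts the solution in l2 rho for
    rho = 2 (a + 2) + 1; stability then bounds it for each x, and uniform
    boundedness makes the bound uniform. *)
Lemma stable_solution_map_bounded (solution : H -> (int -> H) -> Prop) b :
  (forall k, `|b k| <= 2 ^+ k) ->
  (forall x, solution x (zero_ext (solution_map b ^~ x))) ->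
  asymptotically_stable solution ->
  exists2 M, 0 <= M & forall n x, rnorm (solution_map b n x) <= M * rnorm x.
Proof.
move=> b2 sol stable.
have D0 : 1 <= 2 * (a + 2) by have := a0; lra.
have bound n x : rnorm (solution_map b n x) <= rnorm x * (2 * (a + 2)) ^+ n.
  by rewrite mulrC; exact: sconv_resolvent_exp_bound.
apply: (@uniform_boundedness _ _ (fun n => solution_map b n : {linear H -> H})).
  by move=> n; exists ((2 * (a + 2)) ^+ n) => x; rewrite [leRHS]mulrC bound.
move=> x /=.
have /cvg_rnormP lim : (fun n : nat => zero_ext (solution_map b ^~ x) n%:Z) @ \oo --> (0 : H).
  apply: (stable (2 * (a + 2) + 1) _ x _ _ _ (sol x)).
  - by have := a0; lra.
  - by apply: zero_ext_l2 (bound ^~ x); have := a0; lra.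
  - by case=> n; rewrite /spt /= // => _.
have /bounded_fun_has_ubound[M HM] := cvg_seq_bounded (cvgP _ lim).
by exists M => n; have := HM _ (ex_intro2 _ _ n I erefl); rewrite subr0.
Qed.

(** Q = d * (b * Q), so Q_n is a sum of n + 1 operators of norm at most M. *)
Lemma resolvent_subexponential b d (M : R) : 0 <= M -> (forall k, `|d k| <= 1) ->
  cauchy_prod d b = unit_seq ->
  (forall n x, rnorm (solution_map b n x) <= M * rnorm x) ->
  subexponential (fun n => resolvent A c n).
Proof.
move=> M0 d1 db bM s s1.
have lin n x : rnorm (resolvent A c n x) <= n.+1%:R * M * rnorm x.
  have -> : resolvent A c n x = sconv d (solution_map b ^~ x) n.
    by rewrite [X in sconv d X](_ : _ = sconv b (fun n => resolvent A c n x))// sconvA db sconv_unit.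
  apply: le_trans (ler_rnorm_sum _ _ _) _.
  rewrite -mulrA mulr_natl -[X in _ *+ X]card_ord -sumr_const; apply: ler_sum => j _.
  rewrite rnormZ; apply: le_trans (bM (n - j)%N x).
  by rewrite ler_piMl ?rnorm_ge0// -lecR -rnorm_scalar d1.
have s0 : 0 < s by apply: lt_trans s1.
have q01 : 0 <= s^-1 < 1 by rewrite invr_ge0 (ltW s0) /= invf_lt1.
have /andP[q0 q1] := q01; have q'0 : 0 < 1 - s^-1 by rewrite subr_gt0.
exists (s / (1 - s^-1) * M) => [|k x].
  by rewrite !mulr_ge0 ?invr_ge0// ltW.
apply: le_trans (lin k x) _; rewrite ler_wpM2r ?rnorm_ge0// mulrAC ler_wpM2r//.
have := natr_geometric_le k.+1 q01; rewrite exprVn ler_pdivrMr ?exprn_gt0//.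
by move=> /le_trans; apply; rewrite exprS mulrA [s / _]mulrC.
Qed.

Lemma stable_resolvent_subexponential :
  asymptotically_stable (RL_solution al A) \/
  asymptotically_stable (Caputo_solution al A) ->
  subexponential (fun n => resolvent A c n).
Proof.
case=> st.
- have u2 k : `|unit_seq k : R[i]| <= 2 ^+ k.
    by case: k => [|k]; rewrite ?normr1 ?normr0 ?expr0// exprn_ge0.
  have [M M0 bM] := stable_solution_map_bounded u2 RL_solution_map st.
  apply: (resolvent_subexponential (d := unit_seq) M0 _ _ bM).
  + by case=> [|k]; rewrite /unit_seq ?normr1 ?normr0.
  + exact: sconv_unit.
- have [M M0 bM] := stable_solution_map_bounded (fun k => fcoef_sum_norm_le k al01)
    Caputo_solution_map st.
  apply: (resolvent_subexponential (d := fcoef (1 - al)) M0 _ _ bM).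
  + move=> k; apply: fcoef_norm_le1; have /andP[h0 h1] := al01.
    by rewrite subr_ge0 h1 gerBl.
  + exact: fcoef_sum_inv.
Qed.

End Stability.

(** * Inversion of the fractional operator and of the symbol *)

Section LinearBounds.
Context {R : realType} {V W : normedModType R[i]}.

Lemma continuous_linear_rnorm_bound (f : {linear V -> W}) : continuous f ->
  exists2 a, 0 <= a & forall x, rnorm (f x) <= a * rnorm x.
Proof.
move=> /linear_bounded_continuous/linear_boundedP/pinfty_ex_gt0[r r0 fr].
move: r0 (fr); rewrite ltcE => /= /andP[/eqP r_re r0] {}fr.
exists (complex.Re r); first exact: ltW.
move=> x; have := fr x; rewrite !normr_rnorm.
by case: r r_re r0 {fr} => [a b] /= -> a0; rewrite -[(a +i* 0)%C]/((a%:C)%C) -rmorphM /= lecR.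
Qed.

Lemma rnorm_bound_continuous (f : {linear V -> W}) (a : R) :
  (forall x, rnorm (f x) <= a * rnorm x) -> continuous f.
Proof.
move=> fa; apply/linear_bounded_continuous/linear_boundedP.
exists (a%:C)%C; split; first by rewrite complex_real.
move=> r ar x; apply: le_trans (ler_wpM2r (normr_ge0 _) (ltW ar)).
by rewrite !normr_rnorm -rmorphM /= lecR.
Qed.

End LinearBounds.

Section Inversion.
Context {R : realType} {H : completeNormedModType R[i]}.
Variables (A : {linear H -> H}) (a : R) (alpha : R).
Hypothesis a0 : 0 <= a.
Hypothesis Aa : forall x, rnorm (A x) <= a * rnorm x.
Hypothesis alpha01 : 0 < alpha < 1.

Let al : R[i] := (alpha%:C)%C.
Let c := fcoef al.

Let c0 : c 0%N = 1. Proof. exact: fcoef0. Qed.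
Let c1 k : `|c k| <= 1.
Proof. by apply: fcoef_norm_le1; case/andP: alpha01 => h1 h2; rewrite !lecR !ltW. Qed.

Let P n : {linear H -> H} := pencil A c n.
Let Q n : {linear H -> H} := resolvent A c n.

Let sP : subexponential (fun n => P n).
Proof. exact: (pencil_subexponential c1 a0 Aa). Qed.

Hypothesis sQ : subexponential (fun n => resolvent A c n).

Lemma frac_operatorE (mu : R) u : 1 < mu -> expbounded mu u ->
  frac_operator al A u = opconv P 1 u.
Proof.
move=> mu1 [C Cu]; apply/funext => n.
have mu0 : 0 < mu by apply: lt_trans mu1.
have [D D0 DP] := subexponential_rate sP mu1.
have /andP[q0 _] := rate01 mu1.
have g_cvg := geometric_cvg (rate01 mu1) (opconv_term 1 n mu0 q0 D0 DP Cu).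
(* h isolates the contribution of A, which sits in the coefficient of index 1. *)
pose h (k : nat) := if k == 1%N then A (u n) else 0.
have h_cvg : series h @ \oo --> A (u n).
  apply: cvg_near_cst; exists 2%N => // -[|[|m]] //= _.
  rewrite /series /= big_mkord !big_ord_recl /= /h /= add0r big1 ?addr0//.
rewrite -[RHS](addrK (A (u n))) -[LHS]/(_ - A (u n)); congr (_ - _).
apply: cvg_lim => //; apply: cvg_trans (cvgD g_cvg h_cvg).
apply: near_eq_cvg; apply: nearW => N.
rewrite -[LHS]/(series (fun k : nat => P k (u (n + 1 - k%:Z))) N + series h N).
rewrite /series /= -big_split.
apply: eq_bigr => k _; rewrite /P /pencil /h /=.
case: eqP => [->|_]; last by rewrite subr0 addr0.
by rewrite addrK subrK.
Qed.

Lemma opconv_expbounded (K : nat -> {linear H -> H}) (mu : R) b (u : int -> H) : 1 < mu ->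
  subexponential (fun n => K n) -> expbounded mu u -> expbounded mu (opconv K b u).
Proof.
move=> mu1 sK [C Cu]; have [M _ KM] := opconv_bounded b mu1 sK.
by exists (M * C); exact: KM.
Qed.

Lemma frac_operatorK (mu : R) u : 1 < mu -> expbounded mu u ->
  opconv Q (-1) (frac_operator al A u) = u.
Proof.
move=> mu1 uC; rewrite (frac_operatorE mu1 uC).
apply: (opconv_inverse mu1 _ sQ sP _ uC); first by rewrite addNr.
exact: (resolvent_pencil A c0).
Qed.

Lemma frac_operatorKV (mu : R) u : 1 < mu -> expbounded mu u ->
  frac_operator al A (opconv Q (-1) u) = u.
Proof.
move=> mu1 uC; rewrite (frac_operatorE mu1 (opconv_expbounded (K := Q) (-1) mu1 sQ uC)).
apply: (opconv_inverse mu1 _ sP sQ _ uC); first by rewrite subrr.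
exact: (pencil_resolvent A c0).
Qed.

Lemma frac_operator_invertible (mu : R) : 1 < mu ->
  invertible_with_causal_inverse mu (frac_operator al A).
Proof.
move=> mu1; have mu0 : 0 < mu by apply: lt_trans mu1.
have [Pl2 Plin [M PM]] := opconv_l2_bounded_operator 1 mu1 sP.
have E u : l2 mu u -> frac_operator al A u = opconv P 1 u.
  by move=> /(l2_expbounded mu0); exact: frac_operatorE.
split.
  split.
  - by move=> u ul; rewrite E//; exact: Pl2.
  - move=> k u g ul gl; rewrite (E u)// (E g)// -Plin//.
    apply: (frac_operatorE mu1); have [C Cu] := l2_expbounded mu0 ul.
    have [D Dg] := l2_expbounded mu0 gl.
    exists (rnorm (k : R[i]^o) * C + D) => n.
    apply: le_trans (ler_rnormD _ _) _; rewrite mulrDl lerD//.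
    by rewrite rnormZ -mulrA ler_wpM2l ?rnorm_ge0.
  - by exists M => u ul; rewrite E//; exact: PM.
exists (opconv Q (-1)); split; last exact: opconv_causal.
split; first exact: (opconv_l2_bounded_operator (-1) mu1 sQ).
move=> u /(l2_expbounded mu0) uC; split.
- exact: frac_operatorK uC.
- exact: frac_operatorKV uC.
Qed.

Section Resolvent_set.
Variables (mu : R) (z : R[i]).
Hypothesis mu1 : 1 < mu.
Hypothesis zmu : `|z| = (mu%:C)%C.

Let mu0 : 0 < mu. Proof. exact: lt_trans mu1. Qed.

Let z0 : z != 0.
Proof. by rewrite -normr_gt0 zmu ltcR. Qed.

Definition expseq (x : H) : int -> H := fun n => z ^ n *: x.

Lemma rnorm_exprz n : rnorm (z ^ n : R[i]^o) = mu ^ n.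
Proof.
have rz : rnorm (z : R[i]^o) = mu by apply/(@complexI R); rewrite -rnorm_scalar.
have rX m : rnorm (z ^+ m : R[i]^o) = mu ^+ m.
  elim: m => [|m IH]; last by rewrite !exprS rnormM rz IH.
  by apply/(@complexI R); rewrite -rnorm_scalar !expr0 normr1.
case: n => n; first exact: rX.
rewrite !NegzE -!exprnN -rX; apply/(@complexI R).
by rewrite -rnorm_scalar normfV rnorm_scalar fmorphV.
Qed.

Lemma expseq_expbounded x : expbounded mu (expseq x).
Proof. by exists (rnorm x) => n; rewrite rnormZ rnorm_exprz mulrC. Qed.

Lemma pow1p_cvg :
  series (fun k => gbinom al k * (- z^-1) ^+ k : R[i]^o) @ \oo --> (pow1p al (- z^-1) : R[i]^o).
Proof.
have q01 : 0 <= mu^-1 < 1 by rewrite invr_ge0 (ltW mu0) invf_lt1.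
apply: (complex_geometric_cvg (C := 1) q01) => k.
rewrite mul1r -lecR -rnorm_scalar normrM normrX normrN normfV zmu.
have : `|gbinom al k| <= 1.
  by have := c1 k; rewrite /c /fcoef normrM normrX normrN normr1 expr1n mul1r.
move=> /(ler_wpM2r _) h; rewrite -fmorphV -rmorphXn /=.
by apply: le_trans (h _ _) _; rewrite ?mul1r// ler0c exprn_ge0// invr_ge0 ltW.
Qed.

(** Exponential sequences are eigenvectors of the shift, so the operator acts on
    them through its symbol. *)
Lemma frac_operator_expseq x :
  frac_operator al A (expseq x) = expseq (symbol al z *: x - A x).
Proof.
apply/funext => n; rewrite /frac_operator /expseq scalerBr -[LHS]/(_ - A (z ^ n *: x)).
rewrite linearZ; congr (_ - _).
rewrite /Defs.shift /frac_diff; apply: cvg_lim => //.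
have -> : z ^ n *: (symbol al z *: x) = pow1p al (- z^-1) *: (z ^ (n + 1) *: x).
  by rewrite !scalerA /symbol expfzDr// expr1z; congr (_ *: _); ring.
apply: cvg_trans (@cvgZr_tmp _ H _ _ _ _ _ (z ^ (n + 1) *: x) pow1p_cvg).
apply: near_eq_cvg; apply: nearW => N; rewrite /series /= scaler_suml.
apply: eq_bigr => k _; rewrite !scalerA; congr (_ *: _).
have -> : z ^ (n + 1 - k%:Z) = z ^ (n + 1) * z^-1 ^+ k.
  by rewrite [LHS]expfzDr// -exprnN exprVn.
by rewrite -[- z^-1]mulN1r exprMn; ring.
Qed.

(** The inverse of f(z) - A at y, read off at index 0 from the preimage of the
    sequence n |-> z^n y. *)
Definition resolvent_at (y : H) : H := opconv Q (-1) (expseq y) 0.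

Lemma opconv_expseq y : opconv Q (-1) (expseq y) = expseq (resolvent_at y).
Proof.
apply/funext => n; rewrite /resolvent_at /opconv /expseq.
have [D D0 DQ] := subexponential_rate sQ mu1.
have /andP[q0 _] := rate01 mu1.
have [C Cy] := expseq_expbounded y.
have g_cvg := geometric_cvg (rate01 mu1) (opconv_term (-1) 0 mu0 q0 D0 DQ Cy).
apply: cvg_lim => //; apply: cvg_trans (cvgZl_tmp (k := z ^ n) g_cvg).
apply: near_eq_cvg; apply: nearW => N; rewrite /series /= scaler_sumr.
apply: eq_bigr => k _; rewrite /expseq.
transitivity (Q k (z ^ n *: (z ^ (0 - 1 - k%:Z) *: y))); first by rewrite [RHS]linearZ.
by rewrite scalerA -expfzDr//; congr (Q k (z ^ _ *: y)); ring.
Qed.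

Lemma resolvent_at_linear : linear resolvent_at.
Proof.
move=> k x y; rewrite /resolvent_at.
have -> : expseq (k *: x + y) = k *: expseq x + expseq y.
  by apply/funext => n; rewrite /expseq scalerDr [_ + _]/= !scalerA mulrC -scalerA.
by rewrite (opconv_lin _ _ mu1 sQ) //; exact: expseq_expbounded.
Qed.

HB.instance Definition _ := GRing.isLinear.Build R[i] H H *:%R
  resolvent_at resolvent_at_linear.

Lemma symbol_bounded_invertible :
  bounded_invertible (fun x => symbol al z *: x - A x).
Proof.
exists (resolvent_at : {linear H -> H}); split.
- have [M _ QM] := opconv_bounded (-1) mu1 sQ.
  apply: (@rnorm_bound_continuous _ _ _ _ M) => x.
  have := QM (rnorm x) (expseq x) _ 0; rewrite expr0z mulr1; apply => n.
  by rewrite rnormZ rnorm_exprz mulrC.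
- move=> x /=; rewrite /resolvent_at -frac_operator_expseq.
  by rewrite (frac_operatorK mu1 (expseq_expbounded x)) /expseq expr0z scale1r.
- move=> y /=; have := frac_operatorKV mu1 (expseq_expbounded y).
  rewrite opconv_expseq frac_operator_expseq => /(congr1 (fun u => u 0)).
  by rewrite /expseq expr0z !scale1r.
Qed.

End Resolvent_set.
End Inversion.

Theorem proposition4p10 (R : realType) (H : completeNormedModType R[i])
    (dot : {dot H for @Num.conj R[i]}) (Hdot : hilbert_norm dot)
    (Hsep : separable_space H)
    (alpha : R) (alpha01 : 0 < alpha < 1)
    (A : {linear H -> H}) (contA : continuous A)
    (stable : asymptotically_stable (RL_solution (alpha%:C)%C A) \/
              asymptotically_stable (Caputo_solution (alpha%:C)%C A)) :
  (forall mu : R, 1 < mu ->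
     invertible_with_causal_inverse mu (frac_operator (alpha%:C)%C A)) /\
  (forall mu : R, 1 < mu ->
     spectrum A `&` (symbol (alpha%:C)%C @` circle mu) = set0).
Proof.
have [a a0 Aa] := continuous_linear_rnorm_bound contA.
have sQ := stable_resolvent_subexponential a0 Aa alpha01 stable.
split=> mu mu1; first exact: (frac_operator_invertible a0 Aa).
rewrite -subset0 => l [/= ninv [z zmu zE]]; apply: ninv; rewrite -zE.
exact: (symbol_bounded_invertible a0 Aa alpha01 sQ mu1 zmu).
Qed.
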